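(* Let $G=(V,E,\sigma,o)$ be a proper infinite weighted rooted tree and let $p\in(1,\infty)$. Then $$\lim_{n\to\infty}\mathrm{Mod}_{p,\sigma}(\Gamma_n)=\mathrm{Mod}_{p,\sigma}(\Gamma_\infty).$$
   Context: A weighted rooted tree $G=(V,E,\sigma,o)$ is a tree with root vertex $o$ and edge weights $\sigma:E\to\mathbb{R}_{>0}$. The generation $\mathrm{gen}(e)$ of an edge $e$ is the number of edges of the unique path starting at $o$ and ending with $e$ (edges at $o$ have generation $1$). An edge $e$ is the parent of an edge $e'$ (and $e'$ a child of $e$) if they are adjacent and $\mathrm{gen}(e')=\mathrm{gen}(e)+1$; $c(e)$ denotes the set of children of $e$. $G$ is a proper infinite tree if it is infinite, locally finite, and every edge has at least one child. A descending path is a (finite or infinite) path $\gamma=e_1e_2e_3\cdots$ starting at $o$ with $e_i$ the parent of $e_{i+1}$ for all $i$. For $n\ge1$, $\Gamma_n$ is the set of descending paths with exactly $n$ edges and $\Gamma_\infty$ the set of infinite descending paths. A density is a function $\rho:E\to[0,\infty)$; its $\rho$-length on a path is $\ell_\rho(\gamma)=\sum_{e\in\gamma}\rho(e)\in[0,\infty]$. For a family $\Gamma$ of descending paths, $\mathrm{Adm}(\Gamma)=\{\rho\ge 0:\ell_\rho(\gamma)\ge1\ \forall\gamma\in\Gamma\}$. For $1\le p<\infty$ the energy is $\mathcal{E}_{p,\sigma}(\rho)=\sum_{e\in E}\sigma(e)\rho(e)^p\in[0,\infty]$, and $\mathcal{E}_{\infty,\sigma}(\rho)=\sup_{e\in E}\sigma(e)\rho(e)$.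 The $p$-modulus is $\mathrm{Mod}_{p,\sigma}(\Gamma)=\inf_{\rho\in\mathrm{Adm}(\Gamma)}\mathcal{E}_{p,\sigma}(\rho)$. *)

(* Defs.v *)
From mathcomp Require Import all_boot all_order all_algebra.
From mathcomp Require Import all_classical all_reals all_analysis.

Set Implicit Arguments.
Unset Strict Implicit.
Unset Printing Implicit Defensive.

Import Order.TTheory GRing.Theory Num.Theory.
Import numFieldNormedType.Exports.

Local Open Scope classical_set_scope.
Local Open Scope ring_scope.

Definition adjacent (V E : choiceType) (ends : E -> set V) : rel V :=
  fun x y => `[< exists e, ends e = [set x; y] >].

(* A simple graph is a type of edges with their two-element sets of endpoints;
   injectivity of [ends] excludes multiple edges and [ends_pair] excludes loops.
   A tree is a connected graph without simple cycles of length at least 3. *)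
Record weightedRootedTree (R : realType) := WeightedRootedTree {
  vertex : choiceType;
  edge : choiceType;
  ends : edge -> set vertex;
  weight : edge -> R;
  root : vertex;
  ends_pair : forall e, exists x y, x <> y /\ ends e = [set x; y];
  ends_inj : injective ends;
  tree_connected : forall x y, exists s,
    path (adjacent ends) x s /\ last x s = y;
  tree_acyclic : forall s, ucycle (adjacent ends) s -> (size s <= 2)%N;
  weight_gt0 : forall e, 0 < weight e
}.

Section Tree.
Context {R : realType} (G : weightedRootedTree R).

Inductive edgeSeq :=
  | FinSeq of seq (edge G)
  | InfSeq of nat -> edge G.

Definition edges_of (g : edgeSeq) : set (edge G) :=
  match g with
  | FinSeq s => [set` s]
  | InfSeq f => range f
  end.

(* The i-th edge joins the i-th and (i+1)-st of a sequence of pairwise distinct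
   vertices whose 0-th term is [x]. *)
Definition path_from (x : vertex G) (g : edgeSeq) : Prop :=
  match g with
  | FinSeq s => exists2 vs, uniq (x :: vs) &
      [seq ends e | e <- s] = pairmap (fun y z => [set y; z]) x vs
  | InfSeq f => exists v : nat -> vertex G,
      [/\ injective v, v 0%N = x & forall i, ends (f i) = [set v i; v i.+1]]
  end.

(* [get] picks the only element of the set: in a tree there is exactly one path
   from the root with last edge [e]. *)
Definition gen (e : edge G) : nat :=
  get [set n | exists s,
    path_from (root G) (FinSeq (rcons s e)) /\ size (rcons s e) = n].

Definition edge_adjacent (e e' : edge G) : Prop :=
  e <> e' /\ ends e `&` ends e' !=set0.

Definition parent (e e' : edge G) : Prop :=
  edge_adjacent e e' /\ gen e' = (gen e).+1.

Definition children (e : edge G) : set (edge G) := [set e' | parent e e'].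

Definition locally_finite : Prop :=
  forall x : vertex G, finite_set [set e : edge G | ends e x].

Definition proper_infinite : Prop :=
  [/\ infinite_set [set: vertex G], locally_finite &
      forall e : edge G, children e !=set0].

Definition descending (g : edgeSeq) : Prop :=
  path_from (root G) g /\
  match g with
  | FinSeq s => sorted (fun e e' => `[< parent e e' >]) s
  | InfSeq f => forall i, parent (f i) (f i.+1)
  end.

(* [Gamma 0] consists of the empty path, for which no density is admissible, so
   [Mod p (Gamma 0)] is +oo; this does not affect limits in n. *)
Definition Gamma (n : nat) : set edgeSeq :=
  [set g | descending g /\ exists2 s, g = FinSeq s & size s = n].

Definition Gamma_infty : set edgeSeq :=
  [set g | descending g /\ exists f, g = InfSeq f].

Definition rho_length (rho : edge G -> R) (g : edgeSeq) : \bar R :=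
  \esum_(e in edges_of g) (rho e)%:E.

Definition Adm (F : set edgeSeq) : set (edge G -> R) :=
  [set rho | (forall e, 0 <= rho e) /\
             (forall g, F g -> (1 <= rho_length rho g)%E)].

Definition energy (p : R) (rho : edge G -> R) : \bar R :=
  \esum_(e in [set: edge G]) (weight e * rho e `^ p)%:E.

Definition Mod (p : R) (F : set edgeSeq) : \bar R :=
  ereal_inf [set energy p rho | rho in Adm F].

End Tree.

Arguments Gamma {R} G n.
Arguments Gamma_infty {R} G.

(* Main.v *)
(* The moduli of Gamma_n decrease in n and stay above the modulus of Gamma_infty,
   because prefixes of descending paths are descending.  Conversely let rho be
   admissible for Gamma_infty and 0 < t < 1.  If for every n some path with n
   edges had rho-length below t, then Koenig's lemma, applied to the finite
   descending paths of rho-length below t, would give an infinite descending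
   path of rho-length at most t < 1.  Hence rho / t is admissible for some
   Gamma_n, at the cost of a factor t^-p in the energy; let t tend to 1. *)
Require Import Defs.
From mathcomp Require Import all_boot all_order all_algebra.
From mathcomp Require Import all_classical all_reals all_analysis.
Import Order.TTheory GRing.Theory Num.Theory.
Import numFieldNormedType.Exports.
Local Open Scope classical_set_scope.
Local Open Scope ring_scope.

(** The sequences satisfying [P] form a finitely branching tree. The branch is grown through nodes
    that have descendants at every depth. *)
Lemma koenig (T : eqType) (P : seq T -> Prop) :
  (forall s t, P (s ++ t) -> P s) ->
  (forall s, finite_set [set x | P (rcons s x)]) ->
  (forall n, exists2 s, size s = n & P s) ->
  exists f : nat -> T, forall n, P (mkseq f n).
Proof.
move=> Ppre Pfin Pinf.
pose ext s := forall n, exists2 t, size t = n & P (s ++ t).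
have extS s : ext s -> exists x, ext (rcons s x).
  move=> exts; apply: contrapT => /forallNP noext.
  have /choice[h hP] x : exists n, forall t, size t = n -> ~ P (rcons s x ++ t).
    have /existsNP[n hn] := noext x.
    by exists n => t tn Pt; apply: hn; exists t.
  have /finite_seqP[l lE] := Pfin s.
  (* [h x] is a length by which [rcons s x] cannot be extended. A tail of [s] longer than all of
     these starts with some [x] in [l] and can be cut to exactly [h x] further letters. *)
  have [[//|x t] [tN]] := exts (\max_(x <- l) h x).+1.
  rewrite -cat_rcons => Pxt.
  have xl : x \in l.
    have : [set y | P (rcons s y)] x by apply: Ppre Pxt.
    by rewrite lE.
  apply: (hP x (take (h x) t)).
    by rewrite size_takel// tN; apply: leq_bigmax_seq.
  by apply: (Ppre _ (drop (h x) t)); rewrite -catA cat_take_drop.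
(* [x0] is the default value of [next] at sequences outside [ext]. *)
have [x0 _] : exists x, ext (rcons [::] x) by apply: extS.
have /choice[next nextP] s : exists x, ext s -> ext (rcons s x).
  by have [/extS[x ?]|nexts] := pselect (ext s); [exists x | exists x0].
pose S n := iter n (fun s => rcons s (next s)) [::].
exists (next \o S) => n.
have -> : mkseq (next \o S) n = S n by elim: n => // n IH; rewrite mkseqS IH.
have extSn : ext (S n) by elim: n => // n IH; apply: nextP.
by have [t _ /Ppre] := extSn 0.
Qed.

Lemma map_mkseq (S T : Type) (g : S -> T) (f : nat -> S) n :
  map g (mkseq f n) = mkseq (g \o f) n.
Proof. by rewrite /mkseq -map_comp. Qed.

(** * Sums over arbitrary sets *)

Section Esum.
Local Open Scope ereal_scope.
Context {R : realType} {T : choiceType}.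
Implicit Types (a : T -> \bar R) (A B : set T).

Lemma subset_le_esum A B a : A `<=` B ->
  \esum_(i in A) a i <= \esum_(i in B) a i.
Proof.
move=> AB; apply: ge_ereal_sup => _ [X [finX XA] <-].
by apply: esum_ge; exists X => //; split => //; apply: subset_trans AB.
Qed.

(** Finite subsums give one inequality; applying it to [c^-1] and the scaled family gives the
    other. *)
Lemma ge0_esumZl (c : R) A a : (forall i, 0 <= a i) -> (0 < c)%R ->
  \esum_(i in A) (c%:E * a i) = c%:E * \esum_(i in A) a i.
Proof.
have le (b : T -> \bar R) d : (forall i, 0 <= b i) -> (0 < d)%R ->
    \esum_(i in A) (d%:E * b i) <= d%:E * \esum_(i in A) b i.
  move=> b0 d0; apply: ge_ereal_sup => _ [X [finX XA] <-].
  rewrite -ge0_mule_fsumr//; apply: lee_wpmul2l; first by rewrite lee_fin ltW.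
  by apply: esum_ge; exists X.
move=> a0 c0; apply/eqP; rewrite eq_le le//= -lee_pdivlMl//.
have ca0 i : 0 <= c%:E * a i by rewrite mule_ge0// lee_fin ltW.
have := le _ c^-1%R ca0; rewrite invr_gt0 => /(_ c0).
by under [leLHS]eq_esum do rewrite muleA -EFinM mulVf ?gt_eqF// mul1e.
Qed.

(** Every finite subset of the range already lies in an initial segment of [f]. *)
Lemma esum_range_le (f : nat -> T) a x :
  (forall n, \esum_(i in [set` mkseq f n]) a i <= x) ->
  \esum_(i in range f) a i <= x.
Proof.
move=> le_x; apply: ge_ereal_sup => _ [X [finX Xf] <-].
have [n Xn] : exists n, X `<=` [set` mkseq f n].
  move: finX Xf => /finite_seqP[s ->]; elim: s => [|y s IH] ysf.
    by exists 0%N => z.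
  have [n sn] : exists n, [set` s] `<=` [set` mkseq f n].
    by apply: IH => z zs; apply: ysf; rewrite /= inE zs orbT.
  have [k _ fk] := ysf y (mem_head _ _).
  exists (maxn n k.+1) => z /=; rewrite inE => /predU1P[->|/sn/=].
    by apply/mapP; exists k; rewrite ?mem_iota ?leq_maxr.
  move=> /mapP[i]; rewrite mem_iota add0n => /= i_n ->.
  by apply/mapP; exists i; rewrite // mem_iota add0n (leq_trans i_n) ?leq_maxl.
by apply: le_trans (le_x n); apply: esum_ge; exists X.
Qed.

End Esum.

(** * Descending paths and their prefixes *)

Section Modulus.
Context {R : realType} (G : weightedRootedTree R).
Implicit Types (q : seq (edge G * vertex G)) (rho : edge G -> R).
Local Notation edge_set := (fun y z : vertex G => [set y; z]).

(* Descending paths in which each edge carries its far endpoint: unlike for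
   plain edge sequences, the vertices of a prefix are then visibly a prefix of
   the vertices. *)
Definition marked_path q : Prop :=
  [/\ uniq (Defs.root G :: unzip2 q),
      [seq ends e | e <- unzip1 q] = pairmap edge_set (Defs.root G) (unzip2 q) &
      sorted (fun e e' => `[< parent e e' >]) (unzip1 q)].

Lemma descending_FinSeqP (s : seq (edge G)) :
  descending (FinSeq s) <-> exists2 q, marked_path q & unzip1 q = s.
Proof.
split=> [[[vs uvs sE] ss]|[q [uq qE sq] <-]]; last first.
  by split => //; exists (unzip2 q).
have szE : size s = size vs.
  by have := congr1 size sE; rewrite size_map size_pairmap.
by exists (zip s vs); rewrite /marked_path ?unzip1_zip ?unzip2_zip ?szE.
Qed.

Lemma marked_path_cat q1 q2 : marked_path (q1 ++ q2) -> marked_path q1.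
Proof.
rewrite /marked_path /unzip1 /unzip2 !map_cat -cat_cons cat_uniq pairmap_cat.
case=> /andP[uq1 _] qE /cat_sorted2[sq1 _]; split => //.
(* Both sides are concatenations with first part of length [size q1]. *)
have := congr1 (take (size q1)) qE.
by rewrite !take_size_cat ?size_pairmap ?size_map.
Qed.

Lemma marked_path_rcons q x : marked_path (rcons q x) ->
  ends x.1 = [set last (Defs.root G) (unzip2 q); x.2].
Proof.
case=> _ + _; rewrite /unzip1 /unzip2 !map_rcons -[in RHS]cats1 pairmap_cat/=.
by rewrite cats1 => /rcons_inj[_ ->].
Qed.

Lemma finite_marked_path_rcons q : locally_finite G ->
  finite_set [set x | marked_path (rcons q x)].
Proof.
move=> Gfin; set A := [set e | ends e (last (Defs.root G) (unzip2 q))].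
have finA : finite_set A by apply: Gfin.
(* The new edge is incident to the last vertex, and its mark is one of its two endpoints. *)
apply: (@sub_finite_set _ _ (A `*` \bigcup_(e in A) ends e)).
  move=> -[e v] /marked_path_rcons/= eE.
  have Ae : A e by rewrite /A/= eE; left.
  by split => //; exists e => //; rewrite eE; right.
apply: finite_setX => //; apply: bigcup_finite => // e _.
by have [x [y [_ ->]]] := ends_pair e; apply: finite_set2.
Qed.

Lemma marked_path_InfSeq (f : nat -> edge G * vertex G) :
  (forall n, marked_path (mkseq f n)) -> descending (InfSeq (fst \o f)).
Proof.
move=> fP; pose v i := if i is j.+1 then (f j).2 else Defs.root G.
split; last first.
  move=> i; have [_ _ /(sortedP (f 0%N).1)] := fP i.+2.
  rewrite /unzip1 map_mkseq size_mkseq => /(_ i (leqnn _)).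
  by rewrite !nth_mkseq// => /asboolP.
exists v; split => //.
  (* The prefix with [maxn i j] edges visits [v 0] up to [v (maxn i j)], hence both vertices in
     question. *)
  move=> i j vij; have [+ _ _] := fP (maxn i j).
  have -> : Defs.root G :: unzip2 (mkseq f (maxn i j)) = mkseq v (maxn i j).+1.
    by rewrite /mkseq /= (iotaDl 1 0) /unzip2 -!map_comp.
  by move/mkseq_uniqP; apply; rewrite // inE ltnS ?leq_maxl ?leq_maxr.
move=> i; have := fP i.+1; rewrite mkseqS => /marked_path_rcons -> /=.
by case: i => // i; rewrite mkseqS /unzip2 map_rcons last_rcons.
Qed.

Lemma descending_prefix (f : nat -> edge G) n :
  descending (InfSeq f) -> descending (FinSeq (mkseq f n)).
Proof.
move=> [[v [vinj v0 vE]] fpar]; split; last first.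
  apply/(sortedP (f 0%N)) => i; rewrite size_mkseq => i_n.
  by rewrite !nth_mkseq ?(ltnW i_n)//; apply/asboolP.
(* [path_from] keeps the starting vertex apart, so the list runs from [v 1] to [v n]. *)
exists (mkseq (v \o S) n).
  have -> : Defs.root G :: mkseq (v \o S) n = mkseq v n.+1.
    by rewrite /mkseq /= v0 (iotaDl 1 0) -map_comp.
  exact: mkseq_uniq.
elim: n => // n IH; rewrite !mkseqS map_rcons IH -[in RHS]cats1 pairmap_cat/=.
rewrite cats1 vE; congr (rcons _ [set _; _]).
by case: (n) => // m; rewrite mkseqS last_rcons.
Qed.

(** * Comparison of admissible densities *)

Lemma rho_length_cat rho (s t : seq (edge G)) :
  (rho_length rho (FinSeq s) <= rho_length rho (FinSeq (s ++ t)))%E.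
Proof. by apply: subset_le_esum => e /=; rewrite mem_cat => ->. Qed.

Lemma Adm_GammaS n : Adm (Gamma G n) `<=` Adm (Gamma G n.+1).
Proof.
move=> rho [rho0 rhoP]; split => // g [+ [s gs sn]].
rewrite gs => /descending_FinSeqP[q qP qs].
rewrite -(cat_take_drop n s); apply: le_trans (rho_length_cat _ _ _).
apply: rhoP; split; last by exists (take n s); rewrite ?size_takel ?sn.
apply/descending_FinSeqP; exists (take n q); last by rewrite -qs /unzip1 map_take.
by apply: (@marked_path_cat _ (drop n q)); rewrite cat_take_drop.
Qed.

Lemma Adm_Gamma_infty n : Adm (Gamma G n) `<=` Adm (Gamma_infty G).
Proof.
move=> rho [rho0 rhoP]; split => // g [+ [f gf]]; rewrite gf => fdesc.
apply: (@le_trans _ _ (rho_length rho (FinSeq (mkseq f n)))).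
  apply: rhoP; split; first exact: descending_prefix.
  by exists (mkseq f n); rewrite ?size_mkseq.
by apply: subset_le_esum => _ /mapP[i _ ->]; exists i.
Qed.

Lemma Adm_Gamma_infty_finite rho (t : R) : locally_finite G ->
  Adm (Gamma_infty G) rho -> t < 1 ->
  exists n, forall g, Gamma G n g -> (t%:E <= rho_length rho g)%E.
Proof.
move=> Gfin [rho0 rhoP] t1; apply: contrapT => /forallNP short.
pose P q := marked_path q /\ (rho_length rho (FinSeq (unzip1 q)) < t%:E)%E.
have [|||f fP] := @koenig _ P.
- move=> q1 q2 [/marked_path_cat q1P lt_t]; split => //.
  apply: le_lt_trans lt_t; rewrite /unzip1 map_cat; exact: rho_length_cat.
- move=> q; apply: sub_finite_set (@finite_marked_path_rcons q Gfin).
  by move=> x [].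
- move=> n; have /existsNP[g /not_implyP[[+ [s gs sn]]]] := short n.
  rewrite gs => /descending_FinSeqP[q qP qs] /negP; rewrite -ltNge => lt_t.
  by exists q; [rewrite -sn -qs size_map | split; rewrite ?qs].
have /rhoP : Gamma_infty G (InfSeq (fst \o f)).
  by split; [apply: marked_path_InfSeq => n; case: (fP n) | exists (fst \o f)].
(* Prefixes have length below [t], but their supremum may equal [t]; the strict gap comes from
   [t < 1]. *)
apply/negP; rewrite -ltNge; apply: (@le_lt_trans _ _ t%:E); last by rewrite lte_fin.
apply: esum_range_le => n; apply: ltW.
by have [_] := fP n; rewrite /rho_length /unzip1 map_mkseq.
Qed.

(** * Rescaling and the limit of the moduli *)

Lemma rho_lengthZ rho (c : R) g : (forall e, 0 <= rho e) -> 0 < c ->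
  rho_length (fun e => c * rho e) g = (c%:E * rho_length rho g)%E.
Proof.
move=> rho0 c0; rewrite -ge0_esumZl// => e; by rewrite lee_fin.
Qed.

Lemma energyZ (p : R) rho (c : R) : (forall e, 0 <= rho e) -> 0 < c ->
  energy p (fun e => c * rho e) = ((c `^ p)%:E * energy p rho)%E.
Proof.
move=> rho0 c0; rewrite -ge0_esumZl ?powR_gt0//; last first.
  by move=> e; rewrite lee_fin mulr_ge0 ?powR_ge0 ?ltW ?weight_gt0.
by apply: eq_esum => e _; rewrite powRM ?(ltW c0)// -EFinM mulrCA.
Qed.

Lemma energy_ge0 (p : R) rho : (0 <= energy p rho)%E.
Proof.
by apply: esum_ge0 => e _; rewrite lee_fin mulr_ge0 ?powR_ge0 ?ltW ?weight_gt0.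
Qed.

Lemma Mod_ge0 (p : R) (F : set (edgeSeq G)) : (0 <= Mod p F)%E.
Proof. by apply/ereal_infP => _ [rho _ <-]; apply: energy_ge0. Qed.

Lemma le_Mod (p : R) (F F' : set (edgeSeq G)) : Adm F `<=` Adm F' ->
  (Mod p F' <= Mod p F)%E.
Proof. by move=> FF'; apply: ereal_inf_le_tmp; apply: image_subset. Qed.

Lemma ereal_inf_Mod_Gamma (p : R) : locally_finite G -> 0 < p ->
  ereal_inf (range (fun n => Mod p (Gamma G n))) = Mod p (Gamma_infty G).
Proof.
move=> Gfin p0; apply/eqP; rewrite eq_le; apply/andP; split; last first.
  by apply/ereal_infP => _ [n _ <-]; apply/le_Mod/Adm_Gamma_infty.
apply/ereal_infP => _ [rho rhoP <-]; have [rho0 _] := rhoP.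
(* It suffices to bound [r] times the infimum by the energy of [rho] whenever [0 < r < 1]. *)
apply/lee_mul01Pr => [|r /andP[r0 r1]].
  by apply/ereal_infP => _ [n _ <-]; apply: Mod_ge0.
(* With this [t], rescaling [rho] by [t^-1] multiplies its energy by exactly [r^-1]. *)
pose t := r `^ p^-1.
have t0 : 0 < t by apply: powR_gt0.
have tp : t `^ p = r by rewrite -powRrM mulVf ?gt_eqF// powRr1 ?ltW.
have t1 : t < 1.
  rewrite [ltRHS](_ : 1 = 1 `^ p^-1); last by rewrite powR1.
  by apply: gt0_ltr_powR; rewrite ?invr_gt0// nnegrE ltW.
have [n nP] := Adm_Gamma_infty_finite _ _ Gfin rhoP t1.
have tV0 : 0 < t^-1 by rewrite invr_gt0.
rewrite -lee_pdivlMl//; apply: ge_ereal_inf.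
exists (Mod p (Gamma G n)); first by exists n.
apply: ge_ereal_inf; exists (energy p (fun e => t^-1 * rho e)).
  exists (fun e => t^-1 * rho e) => //; split=> [e|g /nP tg].
    by rewrite mulr_ge0// ltW.
  by rewrite rho_lengthZ// lee_pdivlMl// mule1.
rewrite energyZ//.
have -> // : t^-1 `^ p = r^-1.
by rewrite -[t^-1]powR_inv1 ?ltW// -powRrM mulrC powRrM tp powR_inv1 ?ltW.
Qed.

End Modulus.

Theorem theorem1 (R : realType) (G : weightedRootedTree R) (p : R)
  (hG : proper_infinite G) (hp : 1 < p) :
  Mod p (Gamma G n) @[n --> \oo] --> Mod p (Gamma_infty G).
Proof.
have [_ Gfin _] := hG.
rewrite -ereal_inf_Mod_Gamma//; last exact: lt_trans hp.
apply: ereal_nonincreasing_cvgn; apply/nonincreasing_seqP => n.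
exact/le_Mod/Adm_GammaS.
Qed.
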